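(* Let $d\ge 2$. For any $t\in(0,(d-1)/2]$ there exists a compact set $A\subset\mathbb{R}^d$ with $\dim_H(A)=\dim_B(A)=t$ such that $$\dim_H\{V\in G(d,1): P_V|_A \text{ is not injective}\}=2t.$$
   Context: $\dim_H$ and $\dim_B$ denote Hausdorff and box counting (Minkowski) dimension (the equality $\dim_B(A)=t$ includes the existence of the box dimension). $G(d,1)$ is the Grassmannian of lines through the origin in $\mathbb{R}^d$, and for $V\in G(d,1)$, $P_V$ is the orthogonal projection of $\mathbb{R}^d$ onto $V^\perp$. Hausdorff dimension in $G(d,1)$ is with respect to the metric $\varrho(V,W)=\|P_V-P_W\|$ (operator norm). *)

(* Defs.v *)
From HB Require Import structures.
From mathcomp Require Import all_boot all_order all_algebra.
From mathcomp Require Import all_classical all_reals all_analysis.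

Set Implicit Arguments.
Unset Strict Implicit.
Unset Printing Implicit Defensive.

Import Order.TTheory GRing.Theory Num.Theory.
Import numFieldNormedType.Exports.

Local Open Scope classical_set_scope.
Local Open Scope ring_scope.

(* Hausdorff and box dimension are defined relative to an explicit distance
   function [dist], because the metrics of interest (Euclidean on R^d, operator
   norm of projections on the Grassmannian) are not the ones MathComp-Analysis
   infers from the types: the canonical norm on ['rV_d] is the sup norm. *)
Section Dimensions.
Variables (R : realType) (T : Type) (dist : T -> T -> R).
Implicit Types (A U : set T) (s t delta : R).
Local Open Scope ereal_scope.

(* [-oo] on the empty set. *)
Definition diam U : \bar R :=
  ereal_sup [set r | exists x y, [/\ U x, U y & r = (dist x y)%:E]].

(* [diam U ^ s], with [0 ^ 0 = 1] for nonempty sets and value [0] on the empty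
   set, so that countable covers include the finite ones. *)
Definition hausdorff_gauge s U : \bar R :=
  if U == set0 then 0 else poweR (diam U) s.

Definition hausdorff_premeasure s delta A : \bar R :=
  ereal_inf [set \sum_(0 <= i <oo) hausdorff_gauge s (F i) |
    F in [set F : nat -> set T |
      A `<=` \bigcup_i F i /\ forall i, diam (F i) <= delta%:E]].

(* The supremum is the limit as [delta] tends to [0], since the premeasure is
   nonincreasing in [delta]. *)
Definition hausdorff_measure s A : \bar R :=
  ereal_sup [set hausdorff_premeasure s delta A | delta in [set x | (0 < x)%R]].

Definition hausdorff_dim A : \bar R :=
  ereal_inf [set s%:E | s in [set s | (0 <= s)%R /\ hausdorff_measure s A = 0]].

(* The least number of sets of diameter at most [delta] covering [A], [+oo] if
   no finite cover exists. *)
Definition covering_number delta A : \bar R :=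
  ereal_inf [set n%:R%:E | n in [set n | exists F : 'I_n -> set T,
    A `<=` \bigcup_i F i /\ forall i, diam (F i) <= delta%:E]].

(* The box dimension of [A] exists and equals [t]. *)
Definition has_box_dim A t : Prop :=
  lne (covering_number delta A) * (- ln delta)^-1%:E
    @[delta --> (0%R : R)^'+] --> t%:E.

End Dimensions.

Section EuclideanSpace.
Variables (R : realType) (d : nat).
Implicit Types (x y : 'rV[R]_d).

Definition dot x y : R := \sum_i x 0 i * y 0 i.

Let dot_bilinear : bilinear_for *%R (idfun \; *%R) dot.
Proof.
split=> [y | x] a u v; rewrite /applyr /dot /= mulr_sumr -big_split /=.
  by apply: eq_bigr => i _; rewrite !mxE mulrDl mulrA.
by apply: eq_bigr => i _; rewrite !mxE mulrDr mulrCA.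
Qed.

HB.instance Definition _ :=
  bilinear_isBilinear.Build R 'rV[R]_d 'rV[R]_d R *%R (idfun \; *%R) dot
    dot_bilinear.

Let dot_hermitian x y : dot x y = (-1) ^+ false * idfun (dot y x).
Proof.
by rewrite expr0 mul1r /= /dot; apply: eq_bigr => i _; rewrite mulrC.
Qed.

HB.instance Definition _ :=
  isHermitianSesquilinear.Build R 'rV[R]_d false idfun dot dot_hermitian.

Definition eucl_norm x : R := Num.sqrt (dot x x).

Definition eucl_dist x y : R := eucl_norm (x - y).

Definition opnorm (f : 'End('rV[R]_d)) : R :=
  sup [set eucl_norm (f x) | x in [set x | eucl_norm x <= 1]].

(* [daddv_pi U V] projects onto [U] along [V]. *)
Definition perp_proj (V : {vspace 'rV[R]_d}) : 'End('rV[R]_d) :=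
  daddv_pi (orthov dot V) V.

Definition lines : Type := {V : {vspace 'rV[R]_d} | \dim V == 1%N}.

Definition lines_dist (V W : lines) : R :=
  opnorm (perp_proj (val V) - perp_proj (val W)).

End EuclideanSpace.

(* Main.v *)
(* Let m = d - 1, let 0 < r <= 1/4 satisfy 2^m r^t = 1, and let K be the Cantor
   set of the sums of a_i r^i with digits a_i in {0, 1}. The set consists of a
   copy of K^m at height 0 and a copy of -2 K^m at height 1. Both have
   dimension t, while the differences between the two layers are the points of
   height -1 over K^m + 2 K^m, the self-similar set with digits in
   {0, 1, 2, 3}^m, ratio r and dimension 2t (because 4^m r^(2t) = 1). The lines
   on which the projection is not injective are those spanned by differences,
   and passing from a point of that slice to the line through it contracts
   distances by at most a constant factor, which gives the lower bound 2t. The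
   upper bound holds because the direction map is Lipschitz on pairs of points
   at distance bounded below and the square of the set has box dimension 2t.

   Lower bounds on dimensions come from the mass distribution principle, in the
   form of coding the self-similar sets by base N expansions of points of
   [0, 1[ and pulling covers back to Lebesgue measure. *)
Require Import Defs.
From mathcomp Require Import all_boot all_order all_algebra.
From mathcomp Require Import all_classical all_reals all_analysis.
From mathcomp Require Import lra ring.

Set Implicit Arguments.
Unset Strict Implicit.
Unset Printing Implicit Defensive.

Import Order.TTheory GRing.Theory Num.Theory.
Import numFieldNormedType.Exports.

Local Open Scope classical_set_scope.
Local Open Scope ring_scope.

(** * The Euclidean inner product and norm *)

Lemma dotC (R : realType) d (x y : 'rV[R]_d) : dot x y = dot y x.
Proof. by apply: eq_bigr => i _; rewrite mulrC. Qed.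

Lemma dotZl (R : realType) d a (x y : 'rV[R]_d) : dot (a *: x) y = a * dot x y.
Proof. by rewrite linearZl_LR. Qed.

Lemma dotZr (R : realType) d a (x y : 'rV[R]_d) : dot x (a *: y) = a * dot x y.
Proof. by rewrite linearZr_LR. Qed.

Lemma dot0r (R : realType) d (x : 'rV[R]_d) : dot x 0 = 0.
Proof. by rewrite linear0r. Qed.

Lemma dot_ge0 (R : realType) d (x : 'rV[R]_d) : 0 <= dot x x.
Proof. by apply: sumr_ge0 => i _; rewrite -expr2 sqr_ge0. Qed.

Lemma dot_eq0 (R : realType) d (x : 'rV[R]_d) : (dot x x == 0) = (x == 0).
Proof.
apply/eqP/eqP => [x0|->]; last by rewrite linear0l.
apply/rowP => i; rewrite mxE; apply/eqP; rewrite -sqrf_eq0 expr2.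
apply/eqP; apply: (psumr_eq0P _ x0) => // j _.
by rewrite -expr2 sqr_ge0.
Qed.

(** Cauchy-Schwarz: the squared norm of [dot y y *: x - dot x y *: y] is [dot y y] times the defect
    of the inequality. *)
Lemma dot_sqr_le (R : realType) d (x y : 'rV[R]_d) :
  dot x y ^+ 2 <= dot x x * dot y y.
Proof.
have [->|y0] := eqVneq y 0; first by rewrite !dot0r expr0n mulr0.
have yy : 0 < dot y y by rewrite lt_neqAle eq_sym dot_eq0 y0 dot_ge0.
have := dot_ge0 (dot y y *: x - dot x y *: y).
rewrite linearBl /= !linearBr /= !dotZl !dotZr (dotC y x).
set a := dot x x; set b := dot x y; set c := dot y y in yy *.
rewrite (_ : _ - _ = c * (a * c - b ^+ 2)); last by ring.
by rewrite pmulr_rge0// subr_ge0.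
Qed.

Lemma eucl_norm_ge0 (R : realType) d (x : 'rV[R]_d) : 0 <= eucl_norm x.
Proof. exact: sqrtr_ge0. Qed.

Lemma eucl_norm_sqr (R : realType) d (x : 'rV[R]_d) : eucl_norm x ^+ 2 = dot x x.
Proof. by rewrite sqr_sqrtr// dot_ge0. Qed.

Lemma eucl_norm0 (R : realType) d : eucl_norm (0 : 'rV[R]_d) = 0.
Proof. by rewrite /eucl_norm linear0l sqrtr0. Qed.

Lemma eucl_norm_gt0 (R : realType) d (x : 'rV[R]_d) : (0 < eucl_norm x) = (x != 0).
Proof. by rewrite sqrtr_gt0 lt_neqAle dot_ge0 andbT eq_sym dot_eq0. Qed.

Lemma dot_norm_le (R : realType) d (x y : 'rV[R]_d) :
  `|dot x y| <= eucl_norm x * eucl_norm y.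
Proof.
rewrite -(@ler_pXn2r _ 2)// ?nnegrE ?mulr_ge0 ?eucl_norm_ge0//.
by rewrite real_normK ?num_real// exprMn !eucl_norm_sqr dot_sqr_le.
Qed.

Lemma eucl_normD (R : realType) d (x y : 'rV[R]_d) :
  eucl_norm (x + y) <= eucl_norm x + eucl_norm y.
Proof.
rewrite -(@ler_pXn2r _ 2)// ?nnegrE ?addr_ge0 ?eucl_norm_ge0//.
rewrite sqrrD !eucl_norm_sqr linearDl /= !linearDr /= (dotC y x).
have := le_trans (ler_norm _) (dot_norm_le x y); lra.
Qed.

Lemma eucl_normZ (R : realType) d a (x : 'rV[R]_d) :
  eucl_norm (a *: x) = `|a| * eucl_norm x.
Proof.
by rewrite /eucl_norm dotZl dotZr mulrA -expr2 sqrtrM ?sqr_ge0// sqrtr_sqr.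
Qed.

Lemma eucl_normN (R : realType) d (x : 'rV[R]_d) : eucl_norm (- x) = eucl_norm x.
Proof. by rewrite -scaleN1r eucl_normZ normrN normr1 mul1r. Qed.

Lemma eucl_norm_coord (R : realType) d (x : 'rV[R]_d) i : `|x 0 i| <= eucl_norm x.
Proof.
rewrite -sqrtr_sqr ler_wsqrtr// /dot (bigD1 i)//= expr2 lerDl.
by apply: sumr_ge0 => j _; rewrite -expr2 sqr_ge0.
Qed.

Lemma eucl_norm_le_coord (R : realType) d (x : 'rV[R]_d) (e : R) :
  (forall i, `|x 0 i| <= e) -> eucl_norm x <= d%:R * e.
Proof.
move=> xe; have [|d0] := posnP d.
  move=> d0; subst d; rewrite mul0r (_ : x = 0) ?eucl_norm0//.
  by apply/rowP; case.
have e0 : 0 <= e by exact: le_trans (xe (Ordinal d0)).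
rewrite -(@ler_pXn2r _ 2)// ?nnegrE ?mulr_ge0 ?eucl_norm_ge0//.
rewrite eucl_norm_sqr; apply: (@le_trans _ _ (\sum_(i < d) e ^+ 2)).
  apply: ler_sum => i _.
  by rewrite -expr2 -real_normK ?num_real// lerXn2r// nnegrE.
rewrite sumr_const card_ord exprMn -[e ^+ 2 *+ d]mulr_natl ler_wpM2r ?sqr_ge0//.
by rewrite -natrX ler_nat leq_pmulr.
Qed.

(** * Lines and the projections along them *)

Definition line_proj (R : realType) d (v w : 'rV[R]_d) : 'rV[R]_d :=
  (dot w v / dot v v) *: v.

Lemma mem_perp (R : realType) d (v w : 'rV[R]_d) :
  (w \in orthov (@dot R d) <[v]>) = (dot w v == 0).
Proof. exact: mem_orthov1. Qed.

(** The vector [w - line_proj v w] is orthogonal to [v] and [line_proj v w] lies on the line. The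
    two subspaces meet only in 0, so the projection fixes the first summand and kills the second. *)
Lemma perp_projE (R : realType) d (v w : 'rV[R]_d) :
  perp_proj <[v]> w = w - line_proj v w.
Proof.
have [->|v0] := eqVneq v 0.
  rewrite /line_proj scaler0 subr0 /perp_proj orthov0 daddv_pi_id ?memvf//.
  by rewrite capv0.
have cap0 : (orthov (@dot R d) <[v]> :&: <[v]>)%VS = 0%VS.
  apply/eqP; rewrite -subv0; apply/subvP => u; rewrite memv_cap => /andP[].
  rewrite mem_perp => uv /vlineP[k uk]; move: uv; rewrite uk dotZl.
  by rewrite mulf_eq0 dot_eq0 (negPf v0) orbF => /eqP ->; rewrite scale0r mem0v.
have dw : w - line_proj v w \in orthov (@dot R d) <[v]>.
  rewrite mem_perp linearBl /= /line_proj dotZl divfK ?subrr// dot_eq0//.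
have lv : line_proj v w \in <[v]>%VS by rewrite memvZ// memv_line.
rewrite /perp_proj -{1}(subrK (line_proj v w) w) linearD /=.
rewrite daddv_pi_id//.
have : line_proj v w \in (orthov (@dot R d) <[v]> + <[v]>)%VS.
  by rewrite -[line_proj v w]add0r memv_add// mem0v.
move=> /(daddv_pi_add cap0); rewrite (daddv_pi_id (U := <[v]>%VS))//; last first.
  by rewrite capvC.
by move=> /(canRL (addrK _)) ->; rewrite subrr addr0.
Qed.

Lemma eucl_norm_line_proj (R : realType) d (v w : 'rV[R]_d) :
  eucl_norm (line_proj v w) <= eucl_norm w.
Proof.
have [->|v0] := eqVneq v 0; first by rewrite /line_proj scaler0 eucl_norm0 eucl_norm_ge0.
have nv : 0 < eucl_norm v by rewrite eucl_norm_gt0.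
rewrite /line_proj eucl_normZ normrM normfV -eucl_norm_sqr.
rewrite [`|_ ^+ 2|]ger0_norm ?sqr_ge0// expr2 invfM -!mulrA mulVf ?gt_eqF// mulr1.
by rewrite ler_pdivrMr// dot_norm_le.
Qed.

(** After normalising to unit vectors [a] and [b], the difference of the two projections splits into
    two terms of norm at most [|a - b| |w|] each, and [|a - b|] is at most [2 |u - v| / |u|]. *)
Lemma line_projB_le (R : realType) d (u v w : 'rV[R]_d) : u != 0 -> v != 0 ->
  eucl_norm (line_proj u w - line_proj v w) <=
  4 / eucl_norm u * eucl_norm (u - v) * eucl_norm w.
Proof.
move=> u0 v0.
have nu : 0 < eucl_norm u by rewrite eucl_norm_gt0.
have nv : 0 < eucl_norm v by rewrite eucl_norm_gt0.
set a := (eucl_norm u)^-1 *: u; set b := (eucl_norm v)^-1 *: v.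
have projE (x : 'rV[R]_d) : line_proj x w =
    dot w ((eucl_norm x)^-1 *: x) *: ((eucl_norm x)^-1 *: x).
  by rewrite /line_proj dotZr scalerA -eucl_norm_sqr expr2 invfM; congr (_ *: _); ring.
have na : eucl_norm a = 1 by rewrite eucl_normZ gtr0_norm ?invr_gt0// mulVf// gt_eqF.
have nb : eucl_norm b = 1 by rewrite eucl_normZ gtr0_norm ?invr_gt0// mulVf// gt_eqF.
have ab : eucl_norm (a - b) <= 2 / eucl_norm u * eucl_norm (u - v).
  (* This splitting divides by [|u|] only; the norm of [v] is absorbed in the unit vector [b]. *)
  have -> : a - b = (eucl_norm u)^-1 *: (u - v) +
      ((eucl_norm v - eucl_norm u) / eucl_norm u) *: b.
    rewrite /a /b scalerA scalerBr -addrA; congr (_ + _).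
    rewrite -!scaleNr -scalerDl; congr (_ *: _); field.
    by rewrite !gt_eqF.
  apply: (le_trans (eucl_normD _ _)); rewrite (eucl_normZ _ (u - v)) (eucl_normZ _ b) nb mulr1.
  rewrite normrM !(@gtr0_norm _ (eucl_norm u)^-1) ?invr_gt0//.
  have : `|eucl_norm v - eucl_norm u| <= eucl_norm (u - v).
    rewrite ler_norml; apply/andP; split.
      by have := eucl_normD (u - v) v; rewrite subrK; lra.
    by have := eucl_normD (- (u - v)) u; rewrite eucl_normN opprB subrK; lra.
  rewrite -(ler_pM2r (x := (eucl_norm u)^-1)) ?invr_gt0//; lra.
rewrite !projE -/a -/b.
have -> : dot w a *: a - dot w b *: b = dot w (a - b) *: a + dot w b *: (a - b).
  by rewrite linearBr /= scalerBl scalerBr addrA subrK.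
apply: (le_trans (eucl_normD _ _)); rewrite (eucl_normZ _ a) (eucl_normZ _ (a - b)) na mulr1.
have := dot_norm_le w (a - b); have := dot_norm_le w b; rewrite nb mulr1.
move=> wb wab; have nw := eucl_norm_ge0 w; have nab := eucl_norm_ge0 (a - b).
have := ler_wpM2r nab wb; have := ler_wpM2l nw ab; lra.
Qed.

Lemma opnorm_le (R : realType) d (f : 'End('rV[R]_d)) (M : R) :
  (forall x, eucl_norm x <= 1 -> eucl_norm (f x) <= M) -> opnorm f <= M.
Proof.
move=> fM; apply: ge_sup => [|_ [x x1 <-]]; last exact: fM.
by exists (eucl_norm (f 0)), 0 => //=; rewrite eucl_norm0.
Qed.

(** [M] certifies that the set under the [sup] of [opnorm] is bounded, so that the supremum is a
    genuine one; the estimate then follows by scaling [w] to unit length. *)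
Lemma opnorm_ge (R : realType) d (f : 'End('rV[R]_d)) (M : R) w :
  (forall x, eucl_norm x <= 1 -> eucl_norm (f x) <= M) ->
  eucl_norm (f w) <= opnorm f * eucl_norm w.
Proof.
move=> fM; have [->|w0] := eqVneq w 0; first by rewrite linear0 !eucl_norm0 mulr0.
have nw : 0 < eucl_norm w by rewrite eucl_norm_gt0.
rewrite -ler_pdivrMr// mulrC -[X in X * _]gtr0_norm ?invr_gt0//.
rewrite -eucl_normZ -linearZ; apply: ub_le_sup.
  by exists M => _ [x x1 <-]; exact: fM.
by exists ((eucl_norm w)^-1 *: w) => //=; rewrite eucl_normZ gtr0_norm ?invr_gt0// mulVf ?gt_eqF.
Qed.

Lemma line_of_vec (R : realType) d (v : 'rV[R]_d) : v != 0 ->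
  exists V : lines R d, val V = <[v]>%VS.
Proof.
move=> v0; have dv : \dim <[v]> == 1 by rewrite dim_vline v0.
by exists (exist (fun V : {vspace 'rV[R]_d} => \dim V == 1) <[v]>%VS dv).
Qed.

Lemma perp_projB (R : realType) d (u v w : 'rV[R]_d) :
  (perp_proj <[u]> - perp_proj <[v]>) w = line_proj v w - line_proj u w.
Proof.
by rewrite add_lfunE opp_lfunE !perp_projE opprB addrC addrA subrK.
Qed.

Lemma lines_dist_le (R : realType) d (V W : lines R d) (u v : 'rV[R]_d) :
  val V = <[u]>%VS -> val W = <[v]>%VS -> u != 0 -> v != 0 ->
  lines_dist V W <= 4 / eucl_norm u * eucl_norm (u - v).
Proof.
move=> Vu Wv u0 v0; rewrite /lines_dist Vu Wv; apply: opnorm_le => w w1.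
rewrite perp_projB -eucl_normN opprB; apply: (le_trans (line_projB_le _ u0 v0)).
by rewrite ler_piMr// mulr_ge0 ?divr_ge0 ?eucl_norm_ge0.
Qed.

(** Test the operator on [u]: the projection along [V] kills it, and the one along [W] leaves
    [u - line_proj v u]. *)
Lemma lines_dist_ge (R : realType) d (V W : lines R d) (u v : 'rV[R]_d) :
  val V = <[u]>%VS -> val W = <[v]>%VS ->
  eucl_norm (u - line_proj v u) <= lines_dist V W * eucl_norm u.
Proof.
move=> Vu Wv; have [->|u0] := eqVneq u 0.
  by rewrite /line_proj dotC dot0r mul0r scale0r subr0 eucl_norm0 mulr0.
have -> : u - line_proj v u = - (perp_proj (val V) - perp_proj (val W)) u.
  rewrite Vu Wv perp_projB opprB {2}/line_proj divff ?scale1r// dot_eq0//.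
rewrite eucl_normN; apply: (@opnorm_ge _ _ _ 2) => x x1.
rewrite Vu Wv perp_projB; apply: (le_trans (eucl_normD _ _)).
rewrite eucl_normN.
have := eucl_norm_line_proj v x; have := eucl_norm_line_proj u x; lra.
Qed.

Lemma line_generator (R : realType) d (V : lines R d) :
  exists2 v, v != 0 & val V = <[v]>%VS.
Proof.
case: V => V /= dV; have V1 : \dim V = 1 by apply/eqP.
have vp : vpick V != 0 by rewrite vpick0 -dimv_eq0 V1.
exists (vpick V) => //; apply/esym/eqP.
by rewrite eqEdim V1 dim_vline vp -memvE memv_pick.
Qed.

(** Two points have the same image exactly when their difference lies on the line, and a nonzero
    difference spans it because the line has dimension 1. *)
Lemma not_inj_perp_projP (R : realType) d (A : set 'rV[R]_d) (V : lines R d) :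
  ~ set_inj A (perp_proj (val V)) <->
  exists x y, [/\ A x, A y, x - y != 0 & val V = <[x - y]>%VS].
Proof.
have [v v0 Vv] := line_generator V.
split.
  move=> ninj; apply: contrapT => nex; apply: ninj => x y.
  rewrite !inE => Ax Ay xy; apply: contrapT => /eqP; rewrite -subr_eq0 => xy0.
  apply: nex; exists x, y; split=> //.
  have : perp_proj (val V) (x - y) = 0 by rewrite linearB /= xy subrr.
  rewrite Vv perp_projE => /eqP; rewrite subr_eq0 => /eqP xyE.
  apply/esym/eqP; rewrite eqEdim !dim_vline v0 xy0 andbT -memvE xyE.
  by rewrite memvZ// memv_line.
move=> [x] [y] [Ax Ay xy0 Vxy] inj; move/eqP: xy0; apply; apply/eqP.
rewrite subr_eq0; apply/eqP; apply: inj; rewrite ?inE//.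
apply/eqP; rewrite -subr_eq0 -linearB /= Vxy perp_projE /line_proj.
have [->|xy0] := eqVneq (x - y) 0; first by rewrite scaler0 subrr.
by rewrite divff ?dot_eq0// scale1r subrr.
Qed.

(** * Sums with digits and their limits *)

Definition digit_sum (R : realType) (r : R) (a : nat -> nat) (n : nat) : R :=
  \sum_(i < n) r ^+ i * (a i)%:R.

Definition digit_lim (R : realType) (r : R) (a : nat -> nat) : R :=
  limn (digit_sum r a).

Section DigitSum.
Variables (R : realType) (r : R).
Hypotheses (r0 : 0 < r) (r4 : r <= 4^-1).

Lemma digit_sumS a n : digit_sum r a n.+1 = digit_sum r a n + r ^+ n * (a n)%:R.
Proof. by rewrite /digit_sum big_ord_recr. Qed.

Lemma nondecreasing_digit_sum a : nondecreasing_seq (digit_sum r a).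
Proof.
apply/nondecreasing_seqP => n; rewrite digit_sumS lerDl.
by rewrite mulr_ge0// exprn_ge0// ltW.
Qed.

(** With digits up to 3 the tail from place [n] on is at most [3 r^n / (1 - r)], and [r <= 1/4]
    bounds this by [4 r^n]. *)
Lemma nonincreasing_digit_sum a : (forall i, (a i <= 3)%N) ->
  nonincreasing_seq (fun n => digit_sum r a n + 4 * r ^+ n).
Proof.
move=> a3; apply/nonincreasing_seqP => n; rewrite digit_sumS exprS.
have rn : 0 < r ^+ n by rewrite exprn_gt0.
have an : (a n)%:R <= 3 :> R by rewrite (ler_nat R _ 3).
have := ler_wpM2l (ltW rn) an; have := ler_wpM2r (ltW rn) r4; lra.
Qed.

Lemma digit_sum_le a n k : (forall i, (a i <= 3)%N) ->
  digit_sum r a k <= digit_sum r a n + 4 * r ^+ n.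
Proof.
move=> a3; apply: (@le_trans _ _ (digit_sum r a (maxn n k))).
  by apply: nondecreasing_digit_sum; exact: leq_maxr.
apply: le_trans (nonincreasing_digit_sum a3 (leq_maxl n k)).
by rewrite lerDl mulr_ge0// exprn_ge0// ltW.
Qed.

Lemma is_cvg_digit_sum a : (forall i, (a i <= 3)%N) -> cvgn (digit_sum r a).
Proof.
move=> a3; apply: nondecreasing_is_cvgn; first exact: nondecreasing_digit_sum.
by exists (digit_sum r a 0 + 4 * r ^+ 0) => _ [k _ <-]; exact: digit_sum_le.
Qed.

Lemma digit_lim_ge a n : (forall i, (a i <= 3)%N) ->
  digit_sum r a n <= digit_lim r a.
Proof.
move=> a3; apply: nondecreasing_cvgn_le; last exact: is_cvg_digit_sum.
exact: nondecreasing_digit_sum.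
Qed.

Lemma digit_lim_le a n : (forall i, (a i <= 3)%N) ->
  digit_lim r a <= digit_sum r a n + 4 * r ^+ n.
Proof.
move=> a3; apply: limr_le; first exact: is_cvg_digit_sum.
by near=> k; exact: digit_sum_le.
Unshelve. all: by end_near. Qed.

(** Serves to write a number with digits 0 to 3 as a point of [K + 2 K], with [e] and [f] the two
    binary digits of [a]. *)
Lemma digit_limD a e f : (forall i, (a i <= 3)%N) -> (forall i, (e i <= 3)%N) ->
  (forall i, (f i <= 3)%N) -> (forall i, a i = (e i + 2 * f i)%N) ->
  digit_lim r a = digit_lim r e + 2 * digit_lim r f.
Proof.
move=> a3 e3 f3 aE; apply: cvg_lim => //.
have -> : digit_sum r a = digit_sum r e \+ (fun n => 2 * digit_sum r f n).
  apply/funext => n; rewrite /= /digit_sum mulr_sumr -big_split /=.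
  by apply: eq_bigr => i _; rewrite aE natrD natrM; ring.
apply: cvgD; first exact: is_cvg_digit_sum.
by apply: cvgMr; exact: is_cvg_digit_sum.
Qed.

End DigitSum.

(** * Coding the unit interval *)

(** The first [n] base [N] digits of [x] packed into one integer, that is, the index of the [N]-adic
    interval of level [n] containing [x]. *)
Definition prefix_index (R : realType) (N : nat) (x : R) (n : nat) : nat :=
  Num.truncn (x * N%:R ^+ n).

Lemma prefix_index0 (R : realType) N (x : R) : 0 <= x < 1 -> prefix_index N x 0 = 0.
Proof.
by move=> /andP[x0 x1]; rewrite /prefix_index expr0 mulr1; apply: truncn_def; rewrite x0.
Qed.

Lemma prefix_indexS (R : realType) N (x : R) n : (0 < N)%N -> 0 <= x ->
  (prefix_index N x n.+1 %/ N)%N = prefix_index N x n.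
Proof.
move=> N0 x0; apply/esym/truncn_def; set y := x * N%:R ^+ n.
have NR : 0 < N%:R :> R by rewrite ltr0n.
have y0 : 0 <= x * N%:R ^+ n.+1 by rewrite mulr_ge0// exprn_ge0// ltW.
have yE : x * N%:R ^+ n.+1 = y * N%:R by rewrite /y exprSr mulrA.
rewrite /prefix_index; apply/andP; split.
  rewrite -(ler_pM2r NR) -yE -natrM.
  by rewrite -truncn_ge_nat// leq_divM.
rewrite -(ltr_pM2r NR) -yE -natrM.
by rewrite -truncn_lt_nat// ltn_ceil.
Qed.

Lemma prefix_index_mem (R : realType) N (x : R) n : (0 < N)%N -> 0 <= x ->
  (prefix_index N x n)%:R / N%:R ^+ n <= x < (prefix_index N x n).+1%:R / N%:R ^+ n.
Proof.
move=> N0 x0; have NR : 0 < N%:R ^+ n :> R by rewrite exprn_gt0// ltr0n.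
rewrite ler_pdivrMr// ltr_pdivlMr//; apply: truncn_itv.
by rewrite mulr_ge0// ltW.
Qed.

Section Code.
Variables (R : realType) (b m : nat).
Local Notation N := (b.+1 ^ m)%N.

Definition letter (q : nat) : {ffun 'I_m -> 'I_b.+1} :=
  nth [ffun=> ord0] (enum {: {ffun 'I_m -> 'I_b.+1}}) q.

Lemma letter_inj q q' : (q < N)%N -> (q' < N)%N -> letter q = letter q' -> q = q'.
Proof.
have cN : size (enum {: {ffun 'I_m -> 'I_b.+1}}) = N.
  by rewrite -cardE card_ffun !card_ord.
by move=> qN qN' /eqP; rewrite nth_uniq ?cN ?enum_uniq// => /eqP.
Qed.

(* The [i]-th digit vector of [x], read off its expansion in base
   [b.+1 ^ m]. *)
Definition digit_code (x : R) (j : 'I_m) (i : nat) : nat :=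
  letter (prefix_index N x i.+1 %% N) j.

Lemma digit_code_le x j i : (digit_code x j i <= b)%N.
Proof. by rewrite -ltnS /digit_code. Qed.

Variable r : R.
Hypotheses (r0 : 0 < r) (r4 : r <= 4^-1) (b3 : (b <= 3)%N).

(** The first differing letter contributes at least [r^n] in some coordinate. Each later place can
    undo at most [3 r^n], out of a gap of at least [r^n / r >= 4 r^n], so at least [r^n] survives.
    The factor [r] on the right avoids the exponent [n - 1]. *)
Lemma digit_code_separated x y n : 0 <= x < 1 -> 0 <= y < 1 ->
  prefix_index N x n <> prefix_index N y n ->
  exists j, r ^+ n <= r * `|digit_sum r (digit_code x j) n - digit_sum r (digit_code y j) n|.
Proof.
move=> x01 y01; have N0 : (0 < N)%N by rewrite expn_gt0.
have [[x0 x1] [y0 y1]] := (andP x01, andP y01).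
have digit3 j i : `|(digit_code x j i)%:R - (digit_code y j i)%:R| <= 3 :> R.
  have h z : 0 <= (digit_code z j i)%:R :> R /\ (digit_code z j i)%:R <= 3 :> R.
    by rewrite ler0n (ler_nat R _ 3) (leq_trans (digit_code_le _ _ _)).
  have := h x; have := h y; rewrite ler_norml; lra.
elim: n => [|n IH]; first by rewrite !prefix_index0.
have rn : 0 < r ^+ n by rewrite exprn_gt0.
have dE j : digit_sum r (digit_code x j) n.+1 - digit_sum r (digit_code y j) n.+1 =
   (digit_sum r (digit_code x j) n - digit_sum r (digit_code y j) n) +
   r ^+ n * ((digit_code x j n)%:R - (digit_code y j n)%:R).
  by rewrite !digit_sumS; ring.
have [e|ne _] := pselect (prefix_index N x n = prefix_index N y n); last first.
  have [j hj] := IH ne; exists j; rewrite dE exprS.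
  have h1 := lerB_normD (digit_sum r (digit_code x j) n - digit_sum r (digit_code y j) n)
    (r ^+ n * ((digit_code x j n)%:R - (digit_code y j n)%:R)).
  rewrite normrM gtr0_norm// in h1.
  have h2 := ler_wpM2l (ltW rn) (digit3 j n).
  rewrite ler_pM2l//.
  set D := `|_ + _| in h1 *; set E := `|_ - _| in hj h1; set e := _ * `|_| in h1 h2.
  move: (r ^+ n) rn hj h1 h2 => q q0 hj h1 h2.
  have h3 : r * (4 * q) <= q by have := ler_wpM2r (ltW q0) r4; lra.
  have : r * (E - 3 * q) <= r * D by rewrite ler_pM2l//; lra.
  rewrite -(ler_pM2l r0); lra.
move=> ne.
(* The prefixes agree up to level [n], so the new letters must differ. *)
have {}ne : letter (prefix_index N x n.+1 %% N) <> letter (prefix_index N y n.+1 %% N).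
  move=> /letter_inj; rewrite !ltn_mod N0 => /(_ isT isT) mE; apply: ne.
  by rewrite (divn_eq (prefix_index N x n.+1) N) (divn_eq (prefix_index N y n.+1) N)
    mE !prefix_indexS// e.
have [j cj] : exists j, digit_code x j n <> digit_code y j n.
  apply: contrapT => h; apply: ne; apply/ffunP => j; apply/val_inj/eqP.
  by rewrite -/(digit_code x j n) -/(digit_code y j n); apply: contra_notT h => /eqP ?; exists j.
exists j; rewrite dE.
(* Agreement at level [n] descends to all lower levels by division by [N]; hence all earlier digits
   coincide. *)
have same k : (k <= n)%N -> prefix_index N x k = prefix_index N y k.
  move=> kn; have -> : k = (n - (n - k))%N by rewrite subKn.
  elim: (n - k)%N (leq_subr k n) => [|l IHl] ln; first by rewrite subn0.
  have := IHl (ltnW ln); rewrite -{1 2}(subnSK ln) => h.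
  by rewrite -(prefix_indexS _ N0 x0) -(prefix_indexS _ N0 y0) h.
have -> : digit_sum r (digit_code x j) n = digit_sum r (digit_code y j) n.
  by apply: eq_bigr => i _; rewrite /digit_code same.
rewrite subrr add0r normrM gtr0_norm// exprS ler_pM2l//.
rewrite ler_peMr ?(ltW rn)//.
wlog: x y cj {x0 x1 y0 y1 x01 y01 digit3 IH e same ne dE} / (digit_code x j n < digit_code y j n)%N.
  move=> h; have [/h|/h|] := ltngtP (digit_code x j n) (digit_code y j n) => //; first exact.
  by rewrite distrC; apply; apply/nesym.
move=> lt; rewrite distrC ger0_norm.
  by rewrite lerBrDr addrC natr1 ler_nat.
by rewrite subr_ge0 ler_nat ltnW.
Qed.
End Code.

Lemma expr_lt_ex (R : realType) (r y : R) : 0 < r < 1 -> 0 < y ->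
  exists n, r ^+ n < y.
Proof.
move=> /andP[r0 r1] y0; have : r ^+ n @[n --> \oo] --> 0.
  by apply: cvg_expr; rewrite gtr0_norm.
move/cvgrPdist_lt => /(_ y y0)[n _ /(_ n)] /= /(_ (leqnn n)) h.
by exists n; move: h; rewrite sub0r normrN gtr0_norm// exprn_gt0.
Qed.

Lemma expr_scale (R : realType) (r y : R) : 0 < r < 1 -> 0 < y <= 1 ->
  exists k, r ^+ k.+1 < y <= r ^+ k.
Proof.
move=> r01 /andP[y0 y1]; have ex := expr_lt_ex r01 y0.
case: (ex_minnP ex) => -[|k] h kmin; first by move: h; rewrite expr0 ltNge y1.
exists k; rewrite h /= leNgt; apply/negP => /kmin; by rewrite ltnn.
Qed.

(** * Lower bounds for coded sets *)

Section CoveringLowerBound.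
Variables (R : realType) (b m : nat) (r c : R).
Variables (T : Type) (dist : T -> T -> R) (f : R -> T).
Local Notation N := (b.+1 ^ m)%N.
Local Notation z x j := (digit_lim r (digit_code b x j)).
Hypotheses (r0 : 0 < r) (r4 : r <= 4^-1) (b3 : (b <= 3)%N) (c0 : 0 < c).
Hypothesis expanding : forall x y (j : 'I_m), 0 <= x < 1 -> 0 <= y < 1 ->
  c * `|z x j - z y j| <= dist (f x) (f y).

Lemma diam_ge (F : set T) p q : F p -> F q -> ((dist p q)%:E <= diam dist F)%E.
Proof. by move=> Fp Fq; apply: ereal_sup_ubound; exists p, q. Qed.

(* Within a set of diameter at most [c r^k] all level [k] truncations lie in a
   cube of side [10 r^k] and are [r^k]-separated, hence a grid of mesh [r^k]
   identifies them. *)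
Lemma small_set_measure (F : set T) k : (diam dist F <= (c * r ^+ k)%:E)%E ->
  exists G : set R, [/\ measurable G, (forall x, 0 <= x < 1 -> F (f x) -> G x) &
    (lebesgue_measure G <= ((11 ^ m)%:R / (N ^ k)%:R)%:E)%E].
Proof.
move=> dF; have N0 : (0 < N)%N by rewrite expn_gt0.
have rk : 0 < r ^+ k by rewrite exprn_gt0.
pose P := [set x | 0 <= x < 1 /\ F (f x)].
have [[x0 Px0]|Pe] := pselect (exists x, P x); last first.
  exists set0; split=> //; last by rewrite measure0 lee_fin divr_ge0.
  by move=> x x01 Fx; apply: Pe; exists x.
pose u (x : R) (j : 'I_m) := digit_sum r (digit_code b x j) k.
have c3 (x : R) (j : 'I_m) i : (digit_code b x j i <= 3)%N.
  exact: leq_trans (digit_code_le b x j i) b3.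
(* The limits differ by at most [r^k] because of the diameter, and truncation costs up to [4 r^k]
   more. *)
have uP x y j : P x -> P y -> `|u x j - u y j| <= 5 * r ^+ k.
  move=> [x01 Fx] [y01 Fy].
  have : `|z x j - z y j| <= r ^+ k.
    rewrite -(ler_pM2l c0); apply: (le_trans (expanding _ x01 y01)).
    by rewrite -lee_fin; apply: le_trans dF; exact: diam_ge.
  have := @digit_lim_ge R r r0 r4 (digit_code b x j) k (c3 x j).
  have := @digit_lim_ge R r r0 r4 (digit_code b y j) k (c3 y j).
  have := @digit_lim_le R r r0 r4 (digit_code b x j) k (c3 x j).
  have := @digit_lim_le R r r0 r4 (digit_code b y j) k (c3 y j).
  rewrite -/(u x j) -/(u y j) !ler_norml; lra.
(* Shifting by [5 r^k] puts the coordinates in [[0, 10 r^k]], hence in 11 grid cells per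
   coordinate. *)
pose g x j : nat := Num.truncn ((u x j - u x0 j + 5 * r ^+ k) / r ^+ k).
have gP x j : P x -> (g x j)%:R * r ^+ k <= u x j - u x0 j + 5 * r ^+ k <
    (g x j).+1%:R * r ^+ k.
  move=> Px; have := uP x x0 j Px Px0; rewrite ler_norml => h.
  have /truncn_itv : 0 <= (u x j - u x0 j + 5 * r ^+ k) / r ^+ k.
    rewrite divr_ge0 ?(ltW rk)//; lra.
  by rewrite ler_pdivlMr// ltr_pdivrMr.
have g11 x j : P x -> (g x j < 11)%N.
  move=> Px; have /andP[h _] := gP x j Px; have := uP x x0 j Px Px0.
  rewrite ler_norml => h'; rewrite ltnS -(ler_nat R) -(ler_pM2r rk); lra.
pose G (tau : {ffun 'I_m -> 'I_11}) : set R :=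
  [set y | exists x, [/\ P x, forall j, g x j = tau j &
     (prefix_index N x k)%:R / N%:R ^+ k <= y < (prefix_index N x k).+1%:R / N%:R ^+ k]].
(* Points in the same cell have truncations closer than [r^k], while distinct prefixes would force a
   gap of at least [r^k / r] in some coordinate. *)
have sameprefix x y : P x -> P y -> (forall j, g x j = g y j) ->
    prefix_index N x k = prefix_index N y k.
  move=> Px Py gxy; apply: contrapT => /(digit_code_separated r0 r4 b3 Px.1 Py.1)[j].
  have := gP x j Px; have := gP y j Py; rewrite gxy -/(u x j) -/(u y j) => h1 h2.
  have : `|u x j - u y j| < r ^+ k.
    move: h1 h2; rewrite -[(g y j).+1]addn1 natrD mulrDl mul1r => h1 h2.
    rewrite ltr_norml; lra.
  rewrite -(ltr_pM2l r0).
  have := ler_wpM2r (ltW rk) r4; lra.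
(* Each class is therefore empty or a single [N]-adic interval of level [k]. *)
have Gmeas tau : measurable (G tau) /\
    (lebesgue_measure (G tau) <= ((N ^ k)%:R^-1)%:E)%E.
  have [[x [Px gx]]|ne] := pselect (exists x, P x /\ forall j, g x j = tau j);
    last first.
    have -> : G tau = set0.
      by apply/seteqP; split=> // y [x [Px gx _]]; apply: ne; exists x.
    by split=> //; rewrite measure0 lee_fin invr_ge0.
  have -> : G tau = `[(prefix_index N x k)%:R / N%:R ^+ k,
                      (prefix_index N x k).+1%:R / N%:R ^+ k[%classic.
    apply/seteqP; split=> y /=; rewrite in_itv /=.
      move=> [x' [Px' gx' h]]; rewrite (sameprefix x x')// => j.
      by rewrite gx gx'.
    by move=> h; exists x.
  split; first exact: measurable_itv.
  rewrite lebesgue_measure_itv /= lte_fin ifT; last first.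
    by rewrite ltr_pM2r ?ltr_nat// invr_gt0 exprn_gt0// ltr0n.
  by rewrite -EFinD lee_fin -mulrBl -natrB// subSnn mul1r -natrX.
pose H : set R := \big[setU/set0]_(tau : {ffun 'I_m -> 'I_11}) G tau.
exists H; split.
- by apply: bigsetU_measurable => tau _; exact: (Gmeas tau).1.
- move=> x x01 Fx; rewrite /H -bigcup_seq.
  have Px : P x by [].
  exists [ffun j => inord (g x j)]; first by rewrite /= mem_index_enum.
  exists x; split=> //; last first.
    by apply: prefix_index_mem => //; case/andP: x01.
  by move=> j; rewrite ffunE inordK// g11.
- pose K A (w : \bar R) := measurable A /\ (lebesgue_measure A <= w)%E.
  have [_ hK] : K (\big[setU/set0]_(tau : {ffun 'I_m -> 'I_11}) G tau)
      (\sum_(tau : {ffun 'I_m -> 'I_11}) ((N ^ k)%:R^-1)%:E)%E.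
    apply: (big_rec2 K) => [|tau A w _ [mA hA]].
      by split; [exact: measurable0|rewrite measure0].
    have [mG hG] := Gmeas tau; split; first exact: measurableU.
    by apply: (le_trans (measureU2 lebesgue_measure mG mA)); exact: leeD.
  apply: (le_trans hK).
  by rewrite sumEFin sumr_const card_ffun !card_ord -[X in X%:E]mulr_natl.
Qed.

(** The [n] pulled-back sets cover [[0, 1[] and have measure at most [11^m / N^k] each. *)
Lemma covering_size_ge n k (F : 'I_n -> set T) :
  (forall i, (diam dist (F i) <= (c * r ^+ k)%:E)%E) ->
  (forall x, 0 <= x < 1 -> exists i, F i (f x)) ->
  (N ^ k)%:R <= n%:R * (11 ^ m)%:R :> R.
Proof.
move=> dF cF; have N0 : (0 < N)%N by rewrite expn_gt0.
have [G hG] := choice (fun i => small_set_measure (dF i)).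
pose e : R := (11 ^ m)%:R / (N ^ k)%:R.
pose K A (w : \bar R) := measurable A /\ (lebesgue_measure A <= w)%E.
have [mG leG] : K (\big[setU/set0]_(i < n) G i) (\sum_(i < n) e%:E)%E.
  apply: (big_rec2 K) => [|i A w _ [mA hA]].
    by split; [exact: measurable0|rewrite measure0].
  have [mGi _ hGi] := hG i; split; first exact: measurableU.
  by apply: (le_trans (measureU2 lebesgue_measure mGi mA)); exact: leeD.
have : (lebesgue_measure (`[0%R, 1%R[%classic : set R) <= (n%:R * e)%:E)%E.
  rewrite sumEFin sumr_const card_ord -mulr_natl in leG.
  apply: (le_trans _ leG); apply: le_measure; rewrite ?inE//.
  move=> x /=; rewrite in_itv /= => x01; rewrite -bigcup_seq.
  by have [i Fi] := cF x x01; exists i; [rewrite /= mem_index_enum|have [_ h _] := hG i; exact: h].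
rewrite lebesgue_measure_itv /= lte_fin ltr01 -EFinD lee_fin subr0.
by rewrite /e mulrA ler_pdivlMr ?mul1r// ltr0n expn_gt0 N0.
Qed.

(** [Nsigma] makes [sigma] the similarity dimension: [N r^sigma = 1]. *)
Variable sigma : R.
Hypotheses (m0 : (0 < m)%N) (sigma0 : 0 < sigma) (Nsigma : N%:R^-1 = r `^ sigma).

Let r01 : 0 < r < 1.
Proof. by rewrite r0 (le_lt_trans r4)// invf_lt1// (ltr_nat R 1 4). Qed.

(** If the diameter [D] satisfies [c r^(k+1) < D <= c r^k], then [N^(-k) = (r^k)^sigma <= (r^k)^s <=
    (D / (c r))^s]. The term [eta] takes care of sets of diameter 0. *)
Lemma small_set_gauge s eta (F : set T) : 0 <= s <= sigma -> 0 < eta ->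
  (diam dist F <= c%:E)%E ->
  exists G : set R, [/\ measurable G, (forall x, 0 <= x < 1 -> F (f x) -> G x) &
    (lebesgue_measure G <= ((11 ^ m)%:R / (c * r) `^ s)%:E * hausdorff_gauge dist s F
       + eta%:E)%E].
Proof.
move=> /andP[s0 ss] eta0 dF.
have gauge0 : (0 <= hausdorff_gauge dist s F)%E.
  by rewrite /hausdorff_gauge; case: ifP => // _; exact: poweR_ge0.
have C0 : (0 <= ((11 ^ m)%:R / (c * r) `^ s)%:E)%E by rewrite lee_fin divr_ge0// powR_ge0.
have [[x0 [x01 Fx0]]|Pe] := pselect (exists x, 0 <= x < 1 /\ F (f x)); last first.
  exists set0; split=> //; first by move=> x x01 Fx; apply: Pe; exists x.
  by rewrite measure0 adde_ge0 ?mule_ge0// lee_fin ltW.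
(* Nonnegativity of [dist] at a coded point comes from [expanding], applied to some coordinate; one
   exists since [m] is positive. *)
have : (0 <= diam dist F)%E.
  apply: le_trans (diam_ge Fx0 Fx0); rewrite lee_fin.
  apply: le_trans (expanding (Ordinal m0) x01 x01).
  by rewrite subrr normr0 mulr0.
have gaugeE : hausdorff_gauge dist s F = poweR (diam dist F) s.
  by rewrite /hausdorff_gauge ifF//; apply/negP => /eqP F0; rewrite F0 in Fx0.
case dE : (diam dist F) dF => [D| |] //; rewrite !lee_fin => Dc D0.
have Nk k : (N ^ k)%:R^-1 = (r ^+ k) `^ sigma :> R.
  by rewrite natrX -exprVn Nsigma -!powR_mulrn ?powR_ge0 ?(ltW r0)// -!powRrM mulrC.
have : exists k, D <= c * r ^+ k /\
    (11 ^ m)%:R / (N ^ k)%:R <= (11 ^ m)%:R / (c * r) `^ s * D `^ s + eta.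
  (* A set of diameter 0 fits every scale, so [k] is taken large enough to push the measure below
     [eta]. *)
  have [D_eq0|Dneq0] := eqVneq D 0.
    have Ni : 0 < (N%:R^-1 : R) < 1.
      rewrite Nsigma powR_gt0//= -[ltRHS](congr1 (fun g => g sigma) (powR1 R)).
      by apply: gt0_ltr_powR; rewrite ?nnegrE ?(ltW r0)//; case/andP: r01.
    have [|k hk] := @expr_lt_ex R N%:R^-1 (eta / (11 ^ m)%:R) Ni.
      by rewrite divr_gt0// ltr0n expn_gt0.
    exists k; rewrite D_eq0 mulr_ge0 ?(ltW c0) ?exprn_ge0 ?(ltW r0)//; split=> //.
    rewrite -[leLHS]add0r lerD ?mulr_ge0 ?divr_ge0 ?powR_ge0 ?invr_ge0 ?powR_ge0//.
    by rewrite mulrC -ler_pdivlMr ?ltr0n ?expn_gt0// natrX -exprVn ltW.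
  have Dgt0 : 0 < D by rewrite lt_neqAle eq_sym Dneq0.
  have [|k /andP[k1 k2]] := @expr_scale R r (D / c) r01.
    by rewrite divr_gt0//= ler_pdivrMr// mul1r.
  exists k; rewrite mulrC -ler_pdivrMr//; split=> //.
  apply: (@le_trans _ _ ((11 ^ m)%:R / (c * r) `^ s * D `^ s)); last first.
    by rewrite lerDl ltW.
  rewrite -mulrA ler_wpM2l// Nk.
  have crs : 0 < (c * r) `^ s by rewrite powR_gt0// mulr_gt0.
  rewrite ler_pdivlMl//.
  apply: (@le_trans _ _ ((c * r) `^ s * (r ^+ k) `^ s)).
    rewrite ler_pM2l//; apply: ger_powR => //.
    by rewrite exprn_gt0//= exprn_ile1 ?(ltW r0)//; case/andP: r01 => _ /ltW.
  rewrite -powRM ?mulr_ge0 ?exprn_ge0 ?(ltW c0) ?(ltW r0)//.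
  apply: ge0_ler_powR; rewrite ?nnegrE ?mulr_ge0 ?exprn_ge0 ?(ltW c0) ?(ltW r0)//.
  by rewrite -mulrA -exprS mulrC -ler_pdivlMr// ltW.
move=> [k [Dk hk]]; have dFk : (diam dist F <= (c * r ^+ k)%:E)%E by rewrite dE lee_fin.
have [G [mG cG leG]] := small_set_measure dFk.
exists G; split=> //; apply: (le_trans leG).
by rewrite gaugeE dE /= -EFinM -EFinD lee_fin.
Qed.

(** If the [s]-measure vanished for some [s < sigma], a cover of total gauge below [1 / (3 C)] would
    pull back to a cover of [[0, 1[] of measure below [1/3 + 1/3], the second third being the sum of
    the [eta] terms. *)
Lemma hausdorff_dim_ge (X : set T) : (forall x, 0 <= x < 1 -> X (f x)) ->
  (sigma%:E <= hausdorff_dim dist X)%E.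
Proof.
move=> Xf; apply: le_ereal_inf_tmp => _ [s [s0 Hs] <-].
rewrite lee_fin leNgt; apply/negP => ss.
pose C : R := (11 ^ m)%:R / (c * r) `^ s.
have C0 : 0 < C by rewrite divr_gt0 ?ltr0n ?expn_gt0// powR_gt0// mulr_gt0.
have : (hausdorff_premeasure dist s c X < ((3 * C)^-1)%:E)%E.
  apply: (@le_lt_trans _ _ 0%E); last by rewrite lte_fin invr_gt0 mulr_gt0.
  by rewrite -Hs; apply: ereal_sup_ubound; exists c.
move=> /ereal_inf_lt[_ [F [XF dF] <-] sumF].
have e0 (i : nat) : 0 < 3^-1 / (2 ^ i.+1)%:R :> R.
  by rewrite divr_gt0// ltr0n expn_gt0.
have s01 : 0 <= s <= sigma by rewrite s0 ltW.
have [G hG] := choice (fun i => small_set_gauge s01 (e0 i) (dF i)).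
have gauge0 i : (0 <= hausdorff_gauge dist s (F i))%E.
  by rewrite /hausdorff_gauge; case: ifP => // _; exact: poweR_ge0.
have : (lebesgue_measure (`[0%R, 1%R[%classic : set R) <=
    \sum_(0 <= i <oo) lebesgue_measure (G i))%E.
  apply: measure_sigma_subadditive => //; first by move=> i; case: (hG i).
  move=> x /=; rewrite in_itv /= => x01; have [i _ Fi] := XF _ (Xf x x01).
  by exists i => //; have [_ h _] := hG i; exact: h.
rewrite lebesgue_measure_itv /= lte_fin ltr01 -EFinD subr0.
apply/negP; rewrite -ltNge.
apply: (@le_lt_trans _ _ (C%:E * (\sum_(0 <= i <oo) hausdorff_gauge dist s (F i)) +
    (3^-1)%:E)%E).
  apply: (@le_trans _ _ (\sum_(0 <= i <oo) (C%:E * hausdorff_gauge dist s (F i) +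
      (3^-1 / (2 ^ i.+1)%:R)%:E))%E).
    by apply: lee_nneseries => [i _ _|i _]; [exact: measure_ge0|case: (hG i)].
  rewrite nneseriesD; last 2 first.
  - by move=> i _ _; rewrite mule_ge0// lee_fin ltW.
  - by move=> i _ _; rewrite lee_fin ltW.
  rewrite nneseriesZl//; apply: leeD => //.
  exact: epsilon_trick0.
have : (0 <= \sum_(0 <= i <oo) hausdorff_gauge dist s (F i))%E by exact: nneseries_ge0.
case: (\sum_(0 <= i <oo) hausdorff_gauge dist s (F i))%E sumF => // w.
rewrite !lte_fin !lee_fin => h w0; change ((C * w + 3^-1)%:E < 1%:E)%E; rewrite lte_fin.
have : C * w < C * (3 * C)^-1 by rewrite ltr_pM2l.
rewrite invfM mulrCA divff ?gt_eqF// mulr1; lra.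
Qed.

End CoveringLowerBound.

(** * Covering bounds and dimensions *)

Section CoveringUpperBound.
Variables (R : realType) (T : Type) (dist : T -> T -> R).
Hypothesis dist_ge0 : forall p q, 0 <= dist p q.

(** A count with one constant for all scales up to 1, rather than a limit, so that it passes to
    pairs of points and through Lipschitz maps by tracking constants. *)
Definition box_dim_le (X : set T) (sigma : R) := exists2 C : R, 0 < C &
  forall delta, 0 < delta <= 1 -> exists n (F : 'I_n -> set T),
    [/\ n%:R <= C * delta `^ (- sigma), X `<=` \bigcup_i F i &
        forall i, (diam dist (F i) <= delta%:E)%E].

Lemma hausdorff_gauge_ge0 s F : (0 <= hausdorff_gauge dist s F)%E.
Proof. by rewrite /hausdorff_gauge; case: ifP => // _; exact: poweR_ge0. Qed.

Lemma hausdorff_gauge_le s delta F : 0 <= s -> 0 <= delta ->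
  (diam dist F <= delta%:E)%E -> (hausdorff_gauge dist s F <= (delta `^ s)%:E)%E.
Proof.
move=> s0 d0 dF; rewrite /hausdorff_gauge; case: ifPn => [_|/set0P[p Fp]].
  by rewrite lee_fin powR_ge0.
have : (0 <= diam dist F)%E.
  by apply: (@le_trans _ _ (dist p p)%:E); [rewrite lee_fin|apply: ereal_sup_ubound; exists p, p].
case: (diam dist F) dF => [D| |] //=; rewrite !lee_fin => dD D0.
by apply: ge0_ler_powR.
Qed.

(** A cover at scale [d] has total gauge at most [C d^(s - sigma)], which tends to 0 with [d]. *)
Lemma box_dim_le_cover X sigma s delta eps : box_dim_le X sigma ->
  0 <= s -> sigma < s -> 0 < delta -> 0 < eps ->
  exists F : nat -> set T, [/\ X `<=` \bigcup_i F i,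
    forall i, (diam dist (F i) <= delta%:E)%E &
    (\sum_(0 <= i <oo) hausdorff_gauge dist s (F i) <= eps%:E)%E].
Proof.
move=> [C C0 HC] s0 ss d0 e0; have ss0 : 0 < s - sigma by rewrite subr_gt0.
(* The solution of [C q^(s - sigma) = eps]. *)
pose q := (eps / C) `^ (s - sigma)^-1.
have q0 : 0 < q by rewrite powR_gt0// divr_gt0.
pose d := Num.min q (Num.min delta 1).
have dpos : 0 < d by rewrite !lt_min q0 d0 ltr01.
have dq : d <= q by rewrite ge_min lexx.
have [ddelta d1] : d <= delta /\ d <= 1.
  by rewrite !ge_min !lexx !orbT.
have [|n [F [nC XF dF]]] := HC d; first by rewrite dpos d1.
(* The finite cover is padded with empty sets, which have gauge 0 and diameter [-oo]. *)
pose G i := if insub i is Some k then F k else set0.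
have dG i : (diam dist (G i) <= d%:E)%E.
  rewrite /G; case: insub => [k|]; first exact: dF.
  rewrite /diam (_ : [set r | _] = set0) ?ereal_sup0 ?leNye//.
  by apply/seteqP; split=> // r [x [y []]].
exists G; split.
- move=> x /XF[ k _ Fk]; exists (val k) => //=.
  by rewrite /G valK.
- by move=> i; apply: (le_trans (dG i)); rewrite lee_fin.
- rewrite (@nneseries_split _ _ 0 n); last by move=> k _; exact: hausdorff_gauge_ge0.
  rewrite [X in (_ + X)%E]eseries0 ?adde0; last first.
    move=> k; rewrite add0n => nk _; rewrite /G insubF ?ltnNge ?nk//.
    by rewrite /hausdorff_gauge eqxx.
  rewrite add0n big_mkord; apply: (@le_trans _ _ (\sum_(i < n) (d `^ s)%:E)%E).
    by apply: lee_sum => i _; apply: hausdorff_gauge_le; rewrite ?(ltW dpos).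
  rewrite sumEFin sumr_const card_ord -mulr_natl lee_fin.
  apply: (@le_trans _ _ (C * d `^ (- sigma) * d `^ s)); first by rewrite ler_wpM2r ?powR_ge0.
  rewrite -mulrA -powRD; last by rewrite (gt_eqF dpos) implybT.
  rewrite mulrC -ler_pdivlMr// addrC.
  have -> : eps / C = q `^ (s - sigma).
    by rewrite /q -powRrM mulVf ?gt_eqF// powRr1// divr_ge0 ?ltW.
  by apply: ge0_ler_powR; rewrite ?nnegrE ?(ltW ss0) ?(ltW dpos) ?(ltW q0).
Qed.

(** Countable stability: for [s > sigma], cover the [j]-th piece with total gauge [eps / 2^(j+1)]
    and merge the covers into one sequence. The set of directions needs this, its counting bounds
    being available only piece by piece. *)
Lemma hausdorff_dim_le (X : set T) (X_ : nat -> set T) sigma : 0 <= sigma ->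
  X `<=` \bigcup_j X_ j -> (forall j, box_dim_le (X_ j) sigma) ->
  (hausdorff_dim dist X <= sigma%:E)%E.
Proof.
move=> sigma0 XX HX; apply/lee_addgt0Pr => e e0; rewrite -EFinD.
set s := sigma + e; have ss : sigma < s by rewrite ltrDl.
have s0 : 0 <= s by rewrite (le_trans sigma0)// ltW.
apply: ereal_inf_lbound; exists s => //; split=> //.
suff pre0 delta : 0 < delta -> hausdorff_premeasure dist s delta X = 0%E.
  apply/eqP; rewrite eq_le; apply/andP; split.
    by apply: ge_ereal_sup => _ [delta d0 <-]; rewrite pre0.
  by rewrite -(pre0 1)//; apply: ereal_sup_ubound; exists 1 => //=.
move=> d0; apply/eqP; rewrite eq_le; apply/andP; split; last first.
  by apply: le_ereal_inf_tmp => _ [F _ <-]; apply: nneseries_ge0 => *; exact: hausdorff_gauge_ge0.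
apply/lee_addgt0Pr => eps eps0; rewrite add0e.
have eps_i (i : nat) : 0 < eps / (2 ^ i.+1)%:R by rewrite divr_gt0// ltr0n expn_gt0.
have [F hF] := choice (fun j => box_dim_le_cover (HX j) s0 ss d0 (eps_i j)).
(* A bijection from [nat] to [nat * nat] enumerates the double family of covering sets. *)
have /card_esym/ppcard_eqP[f] := card_nat2.
pose G n := F (f n).1 (f n).2.
apply: (@le_trans _ _ (\sum_(0 <= n <oo) hausdorff_gauge dist s (G n))%E).
  apply: ereal_inf_lbound; exists G => //; split.
    move=> x /XX[j _ Xj]; have [cF _ _] := hF j; have [i _ Fi] := cF x Xj.
    by exists (f^-1%FUN (j, i)) => //; rewrite /G invK ?inE.
  by move=> n; have [_ h _] := hF (f n).1; exact: h.
apply: (@le_trans _ _ (\sum_(0 <= j <oo) \sum_(0 <= i <oo) hausdorff_gauge dist s (F j i))%E).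
  rewrite nneseries_esumT; last by move=> n; exact: hausdorff_gauge_ge0.
  rewrite [leRHS]nneseries_esumT; last first.
    by move=> n; apply: nneseries_ge0 => *; exact: hausdorff_gauge_ge0.
  under [leRHS]eq_esum do
    (rewrite nneseries_esumT; last by move=> n; exact: hausdorff_gauge_ge0).
  rewrite esum_esum; last by move=> *; exact: hausdorff_gauge_ge0.
  rewrite (@reindex_esum _ _ _ setT _ f)//.
  rewrite (_ : _ `*`` _ = setT); last by apply/seteqP; split.
  exact: 'bij_f.
apply: (le_trans _ (epsilon_trick0 xpredT (ltW eps0))).
apply: lee_nneseries => [j _ _|j _]; last by case: (hF j).
by apply: nneseries_ge0 => *; exact: hausdorff_gauge_ge0.
Qed.

End CoveringUpperBound.

(** * Box dimension from two-sided counting bounds *)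

Lemma cvg_ln_ratio (R : realType) (a t : R) : 0 < a ->
  (ln (a * delta `^ (- t)) * (- ln delta)^-1) @[delta --> (0:R)^'+] --> t.
Proof.
move=> a0; apply/cvgrPdist_le => e e0.
(* The ratio differs from [t] by [ln a / (- ln d)], which is at most [e] once [- ln d >= M]; the 1
   keeps [- ln d] positive. *)
pose M := Num.max 1 (`|ln a| / e).
near=> d.
have d0 : 0 < d by near: d; exact: nbhs_right_gt.
have LM : M <= - ln d.
  rewrite lerNr -[leRHS]expRK ler_ln ?posrE ?expR_gt0// ltW//.
  by near: d; apply: nbhs_right_lt; exact: expR_gt0.
have L0 : 0 < - ln d by apply: lt_le_trans LM; rewrite lt_max ltr01.
rewrite lnM ?posrE ?powR_gt0// ln_powR mulNr -mulrN mulrDl mulfK ?gt_eqF//.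
rewrite opprD addrCA subrr addr0 normrN normrM normfV (gtr0_norm L0).
rewrite ler_pdivrMr// -ler_pdivrMl// mulrC; apply: le_trans LM.
by rewrite le_max lexx orbT.
Unshelve. all: by end_near. Qed.

Section BoxDimension.
Variables (R : realType) (T : Type) (dist : T -> T -> R).

Definition box_dim_ge (X : set T) (sigma : R) := exists2 c : R, 0 < c &
  forall delta n (F : 'I_n -> set T), 0 < delta <= 1 ->
    X `<=` \bigcup_i F i -> (forall i, (diam dist (F i) <= delta%:E)%E) ->
    c * delta `^ (- sigma) <= n%:R.

Lemma has_box_dim_bounds X t : box_dim_le dist X t -> box_dim_ge X t ->
  has_box_dim dist X t.
Proof.
move=> [C C0 HC] [c c0 Hc].
apply: (@squeeze_cvge _ _ _ _
  (fun d => (ln (c * d `^ (- t)) * (- ln d)^-1)%:E) _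
  (fun d => (ln (C * d `^ (- t)) * (- ln d)^-1)%:E)); last 2 first.
- by apply: cvg_EFin; [near=> d|exact: cvg_ln_ratio].
- by apply: cvg_EFin; [near=> d|exact: cvg_ln_ratio].
near=> d.
have d0 : 0 < d by near: d; exact: nbhs_right_gt.
have d1 : d < 1 by near: d; exact: nbhs_right_lt.
have d01 : 0 < d <= 1 by rewrite d0 ltW.
have pos a : 0 < a -> 0 < a * d `^ (- t) by move=> a0; rewrite mulr_gt0// powR_gt0.
have leC : (covering_number dist d X <= (C * d `^ (- t))%:E)%E.
  have [n [F [nC XF dF]]] := HC d d01.
  apply: (@le_trans _ _ n%:R%:E); last by rewrite lee_fin.
  by apply: ereal_inf_lbound; exists n => //; exists F.
have gec : ((c * d `^ (- t))%:E <= covering_number dist d X)%E.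
  apply: le_ereal_inf_tmp => _ [n [F [XF dF]] <-].
  by rewrite lee_fin; exact: Hc XF dF.
have L0 : (0 <= ((- ln d)^-1)%:E)%E.
  by rewrite lee_fin invr_ge0 oppr_ge0 ltW// ln_lt0// d0.
have lne_le (x y : \bar R) : (0 <= x)%E -> (x <= y)%E -> (lne x <= lne y)%E.
  by move=> x0 xy; rewrite lee_lne// in_itv /= ?leey ?andbT// (le_trans x0).
rewrite !EFinM -!lne_EFin ?pos//; apply/andP; split; apply: lee_wpmul2r => //.
  by apply: lne_le => //; rewrite lee_fin ltW// pos.
by apply: lne_le => //; apply: le_trans gec; rewrite lee_fin ltW// pos.
Unshelve. all: by end_near. Qed.

End BoxDimension.

(** * Upper bound for the directions of non-injectivity *)

Lemma eucl_dist_ge0 (R : realType) d (x y : 'rV[R]_d) : 0 <= eucl_dist x y.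
Proof. exact: eucl_norm_ge0. Qed.

Lemma lines_dist_ge0 (R : realType) d (V W : lines R d) : 0 <= lines_dist V W.
Proof.
have [u u0 Vu] := line_generator V; have [v v0 Wv] := line_generator W.
rewrite -(@pmulr_lge0 _ (eucl_norm u)) ?eucl_norm_gt0//.
by apply: le_trans (lines_dist_ge Vu Wv); exact: eucl_norm_ge0.
Qed.

Lemma eucl_dist_diam (R : realType) d (F : set 'rV[R]_d) delta x y :
  (diam (@eucl_dist R d) F <= delta%:E)%E -> F x -> F y -> eucl_norm (x - y) <= delta.
Proof.
move=> dF Fx Fy; rewrite -lee_fin; apply: le_trans dF.
by apply: ereal_sup_ubound; exists x, y.
Qed.

(** Pairs of distinct points are sorted by [|x - y| >= 1 / (j+1)]. On each class the direction is a
    Lipschitz function of the pair, and pairs of covering sets of [A] give [n^2] sets, which doubles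
    the exponent. *)
Lemma hausdorff_dim_not_inj_le (R : realType) d (A : set 'rV[R]_d) t : 0 <= t ->
  box_dim_le (@eucl_dist R d) A t ->
  (hausdorff_dim (@lines_dist R d)
    [set V : lines R d | ~ set_inj A (perp_proj (val V))] <= (2 * t)%:E)%E.
Proof.
move=> t0 [C C0 HC].
pose X_ (j : nat) : set (lines R d) := [set V | exists x y, [/\ A x, A y,
  (j.+1%:R)^-1 <= eucl_norm (x - y) & val V = <[x - y]>%VS]].
apply: (@hausdorff_dim_le _ _ _ (@lines_dist_ge0 R d) _ X_).
- by rewrite mulr_ge0.
- move=> V /not_inj_perp_projP[x [y [Ax Ay xy0 Vxy]]].
  have nxy : 0 < eucl_norm (x - y) by rewrite eucl_norm_gt0.
  exists (Num.truncn (eucl_norm (x - y))^-1) => //; exists x, y; split=> //.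
  by rewrite invf_ple ?posrE// ltW// truncnS_gt.
(* The Lipschitz factor [4 / |x - y|] is at most [4 (j+1)], and the difference moves by at most
   [2 e / D]; the product is [e]. *)
move=> j; pose D : R := 8 * j.+1%:R.
have D0 : 0 < D by rewrite mulr_gt0.
have D1 : 1 <= D by rewrite /D -natrM (ler_nat _ 1).
exists (C * C * D `^ (2 * t)); first by rewrite !mulr_gt0// powR_gt0.
move=> e /andP[e0 e1]; have [|n [F [nC AF dF]]] := HC (e / D).
  by rewrite divr_gt0// ler_pdivrMr// mul1r (le_trans e1).
pose G (p : 'I_n * 'I_n) : set (lines R d) := [set V | exists x y,
  [/\ F p.1 x, F p.2 y, (j.+1%:R)^-1 <= eucl_norm (x - y) & val V = <[x - y]>%VS]].
have pairs : #|{: 'I_n * 'I_n}| = (n * n)%N by rewrite card_prod !card_ord.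
exists (#|{: 'I_n * 'I_n}|), (fun i => G (enum_val i)); split.
- rewrite pairs natrM.
  have -> : C * C * D `^ (2 * t) * e `^ (- (2 * t)) =
      (C * (e / D) `^ (- t)) * (C * (e / D) `^ (- t)).
    have -> : (e / D) `^ (- t) = D `^ t * e `^ (- t).
      rewrite powRM ?invr_ge0 ?(ltW e0) ?(ltW D0)// mulrC; congr (_ * _).
      by rewrite -(powR_inv1 (ltW D0)) -powRrM mulN1r opprK.
    have sq a (s : R) : a != 0 -> a `^ (2 * s) = a `^ s * a `^ s.
      by move=> a0; rewrite -powRD ?a0 ?implybT//; congr powR; ring.
    by rewrite -mulrN !sq ?gt_eqF//; ring.
  by apply: ler_pM.
- move=> V [x [y [Ax Ay hxy Vxy]]].
  have [i1 _ Fi1] := AF _ Ax; have [i2 _ Fi2] := AF _ Ay.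
  by exists (enum_rank (i1, i2)) => //; rewrite enum_rankK; exists x, y.
- move=> i; apply: ge_ereal_sup => _ [V [W [GV GW ->]]].
  have [x [y [Fx Fy hxy Vxy]]] := GV; have [x' [y' [Fx' Fy' hxy' Wxy]]] := GW.
  have j0 : 0 < (j.+1%:R)^-1 :> R by rewrite invr_gt0.
  have nz (u : 'rV[R]_d) : (j.+1%:R)^-1 <= eucl_norm u -> u != 0.
    by move=> hu; rewrite -eucl_norm_gt0; exact: lt_le_trans hu.
  rewrite lee_fin; apply: (le_trans (lines_dist_le Vxy Wxy (nz _ hxy) (nz _ hxy'))).
  have hx := eucl_dist_diam (dF _) Fx Fx'; have hy := eucl_dist_diam (dF _) Fy Fy'.
  have hs : eucl_norm ((x - y) - (x' - y')) <= 2 * (e / D).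
    rewrite (_ : _ - _ = (x - x') + - (y - y')); last first.
      by rewrite !opprB (addrC y' (- x')) addrACA (addrC (- y)).
    by apply: (le_trans (eucl_normD _ _)); rewrite eucl_normN; lra.
  apply: (@le_trans _ _ ((4 * j.+1%:R) * (2 * (e / D)))).
    apply: ler_pM => //; rewrite ?mulr_ge0 ?invr_ge0 ?eucl_norm_ge0//.
    rewrite ler_wpM2l// -[leRHS]invrK lef_pV2// posrE.
    by rewrite eucl_norm_gt0 nz.
  have J0 : j.+1%:R != 0 :> R by rewrite pnatr_eq0.
  rewrite /D; move: (j.+1%:R : R) J0 => J J0.
  by rewrite le_eqVlt; apply/orP; left; apply/eqP; field.
Qed.

(** * The two-layer Cantor set *)

Definition cantor_approx (R : realType) (r : R) n (e : {ffun 'I_n -> bool}) : R :=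
  \sum_(i < n) r ^+ i * (e i)%:R.

(** The intersection form, with finitely many closed intervals per level, gives compactness and the
    counts directly; digit expansions enter through [digit_lim_cantor]. *)
Definition cantor_set (R : realType) (r : R) : set R :=
  [set y | forall n, exists e : {ffun 'I_n -> bool},
     cantor_approx r e <= y <= cantor_approx r e + 4 * r ^+ n].

Lemma cantor_set_bounds (R : realType) (r y : R) : cantor_set r y -> 0 <= y <= 4.
Proof. by move=> /(_ 0)[e]; rewrite /cantor_approx big_ord0 add0r expr0 mulr1. Qed.

Lemma compact_cantor_set (R : realType) (r : R) : compact (cantor_set r).
Proof.
apply: (@subclosed_compact _ _ `[(0 : R), 4]%classic); last 2 first.
- exact: segment_compact.
- by move=> y /cantor_set_bounds; rewrite /= in_itv.
have -> : cantor_set r = \bigcap_n \bigcup_(e in [set: {ffun 'I_n -> bool}])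
    `[cantor_approx r e, cantor_approx r e + 4 * r ^+ n]%classic.
  apply/seteqP; split=> y Ky n.
    by have [e he] := Ky n; exists e => //=; rewrite in_itv.
  by have [e _ he] := Ky n I; exists e; move: he; rewrite /= in_itv.
apply: closed_bigI => n _; apply: closed_bigcup; first exact: finite_finset.
by move=> e _; exact: interval_closed.
Qed.

Lemma digit_lim_cantor (R : realType) (r : R) a : 0 < r -> r <= 4^-1 ->
  (forall i, (a i <= 1)%N) -> cantor_set r (digit_lim r a).
Proof.
move=> r0 r4 a1 n; have a3 i : (a i <= 3)%N by exact: leq_trans (a1 i) _.
exists [ffun i : 'I_n => a i == 1].
have -> : cantor_approx r [ffun i : 'I_n => a i == 1] = digit_sum r a n.
  apply: eq_bigr => i _; rewrite ffunE; congr (_ * _%:R).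
  by have := a1 i; case: (a i) => [|[|]].
by rewrite digit_lim_ge//= digit_lim_le.
Qed.

Definition cons_row (R : realType) m (h : R) (z : 'I_m -> R) : 'rV[R]_m.+1 :=
  \row_i (if unlift ord0 i is Some j then z j else h).

Lemma cons_row0 (R : realType) m (h : R) (z : 'I_m -> R) : cons_row h z 0 0 = h.
Proof. by rewrite mxE unlift_none. Qed.

Lemma cons_rowS (R : realType) m (h : R) (z : 'I_m -> R) j :
  cons_row h z 0 (lift ord0 j) = z j.
Proof. by rewrite mxE liftK. Qed.

Lemma row_bound (R : realType) m (v : 'rV[R]_m.+1) (e : R) :
  `|v 0 0| <= e -> (forall j : 'I_m, `|v 0 (lift ord0 j)| <= e) ->
  eucl_norm v <= m.+1%:R * e.
Proof.
move=> v0 vS; apply: eucl_norm_le_coord => i.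
by case: (unliftP ord0 i) => [j ->|->].
Qed.

Section TwoLayers.
Variables (R : realType) (m : nat) (r : R).
Hypotheses (r0 : 0 < r) (r4 : r <= 4^-1).

(* [K^m] at height [0] and [-2 K^m] at height [1], where [K] is the Cantor set
   of sums of [r^i] with digits [0] and [1]: the differences between the two
   layers are the points of height [-1] over the sums with digits [0] to [3]. *)
Definition layer (h : bool) : set 'rV[R]_m.+1 :=
  [set v | v 0 0 = h%:R /\
    forall j : 'I_m, cantor_set r ((if h then - 2^-1 else 1) * v 0 (lift ord0 j))].

Definition two_layers : set 'rV[R]_m.+1 := layer false `|` layer true.

Lemma compact_layer h : compact (layer h).
Proof.
(* The inverse of the scaling factor in [layer], which exhibits the layer as a product of compact
   sets. *)
pose s : R := if h then - 2 else 1.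
pose B (i : 'I_m.+1) : set R :=
  if unlift ord0 i is Some _ then [set s * y | y in cantor_set r] else [set h%:R].
have -> : layer h = [set v | forall i, B i (v ord0 i)].
  apply/seteqP; split=> v.
    move=> [v0 vS] i; rewrite /B; case: (unliftP ord0 i) => [j ->|->].
      exists ((if h then - 2^-1 else 1) * v 0 (lift ord0 j)); first exact: vS.
      by rewrite /s; case: (h); rewrite ?mul1r// mulrA; field.
    exact: v0.
  move=> Bv; split; first by have := Bv ord0; rewrite /B unlift_none.
  move=> j; have := Bv (lift ord0 j); rewrite /B liftK => -[y Ky <-].
  rewrite mulrA (_ : _ * s = 1) ?mul1r// /s.
  by case: (h); rewrite ?mulr1//; field.
apply: rV_compact => i; rewrite /B; case: (unlift _ _) => [_|].
  apply: continuous_compact; last exact: compact_cantor_set.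
  by apply: continuous_subspaceT => x; apply: cvgMr; exact: cvg_id.
exact: compact_set1.
Qed.

Lemma compact_two_layers : compact two_layers.
Proof. by apply: compactU; exact: compact_layer. Qed.

(** One cell for each layer and each choice of the first [n] binary digits in every coordinate. *)
Let box (n : nat) (p : bool * {ffun 'I_m -> {ffun 'I_n -> bool}}) : set 'rV[R]_m.+1 :=
  [set v | v 0 0 = p.1%:R /\ forall j,
    let y := (if p.1 then - 2^-1 else 1) * v 0 (lift ord0 j) in
    cantor_approx r (p.2 j) <= y <= cantor_approx r (p.2 j) + 4 * r ^+ n].

Lemma two_layers_box n : two_layers `<=` \bigcup_p @box n p.
Proof.
have hb h : layer h `<=` \bigcup_p @box n p.
  move=> v [v0 vS]; have [e he] := choice (fun j => vS j n).
  by exists (h, finfun e) => //; split=> //= j; rewrite ffunE.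
by move=> v [|]; exact: hb.
Qed.

(** The cells have side [4 r^n] before scaling, doubled in the upper layer by the factor -2. *)
Lemma box_diam n p : (diam (@eucl_dist R m.+1) (@box n p) <=
  (m.+1%:R * (8 * r ^+ n))%:E)%E.
Proof.
apply: ge_ereal_sup => _ [v [w [[v0 vS] [w0 wS] ->]]]; rewrite lee_fin.
have rn : 0 < r ^+ n by rewrite exprn_gt0.
apply: row_bound => [|j]; rewrite !mxE.
  by rewrite v0 w0 subrr normr0 mulr_ge0// ltW.
have := vS j; have := wS j; rewrite /= ler_norml; case: (p.1); lra.
Qed.

Variable t : R.
Hypotheses (t0 : 0 < t) (rt : (2 ^ m)%:R^-1 = r `^ t).

Let r01 : 0 < r < 1.
Proof. by rewrite r0 (le_lt_trans r4)// invf_lt1// (ltr_nat R 1 4). Qed.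

Let powN k : ((2 ^ m) ^ k)%:R = (r ^+ k) `^ (- t) :> R.
Proof.
rewrite natrX -[(2 ^ m)%:R]invrK rt powRN -!powR_mulrn ?invr_ge0 ?powR_ge0 ?(ltW r0)//.
by rewrite -(powR_inv1 (powR_ge0 _ _)) -powRN -!powRrM; congr powR; ring.
Qed.

Lemma box_dim_le_two_layers : box_dim_le (@eucl_dist R m.+1) two_layers t.
Proof.
pose D : R := m.+1%:R * 8.
have D0 : 0 < D by rewrite mulr_gt0.
have D1 : 1 <= D by rewrite /D -natrM (ler_nat _ 1).
(* The 2 counts the layers, [2 ^ m] pays for using level [k+1] instead of [k], and the power of [D]
   for the scale [e / D]. *)
exists (2 * (2 ^ m)%:R * D `^ t).
  by rewrite !mulr_gt0 ?powR_gt0// ltr0n expn_gt0.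
move=> e /andP[e0 e1].
have [|k /andP[k1 k2]] := @expr_scale R r (e / D) r01.
  by rewrite divr_gt0// ler_pdivrMr// mul1r (le_trans e1).
pose J := (bool * {ffun 'I_m -> {ffun 'I_k.+1 -> bool}})%type.
have cJ : #|{: J}| = (2 * (2 ^ m) ^ k.+1)%N.
  by rewrite card_prod card_bool !card_ffun card_bool !card_ord -!expnM (mulnC k.+1).
exists #|{: J}|, (fun i => box (enum_val i)); split.
- rewrite cJ expnS !natrM -!mulrA ler_wpM2l// ler_wpM2l// powN.
  have -> : D `^ t * e `^ (- t) = (e / D) `^ (- t).
    rewrite (@powRM _ e D^-1) ?invr_ge0 ?(ltW e0) ?(ltW D0)// [RHS]mulrC; congr (_ * _).
    by rewrite -(powR_inv1 (ltW D0)) -powRrM mulN1r opprK.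
  rewrite !powRN lef_pV2 ?posrE ?powR_gt0 ?exprn_gt0 ?divr_gt0//.
  by apply: ge0_ler_powR;
    rewrite ?nnegrE ?(ltW t0) ?exprn_ge0 ?divr_ge0 ?(ltW r0) ?(ltW e0) ?(ltW D0).
- move=> v /(@two_layers_box k.+1)[p _ hp].
  by exists (enum_rank p) => //; rewrite enum_rankK.
- move=> i; apply: (le_trans (box_diam _)); rewrite lee_fin.
  by rewrite mulrA -/D mulrC -ler_pdivlMr// ltW.
Qed.

Let z2 (x : R) (j : 'I_m) : R := digit_lim r (digit_code 1 x j).

Let layer0_code (x : R) : two_layers (cons_row 0 (z2 x)).
Proof.
left; split; first by rewrite cons_row0.
move=> j; rewrite cons_rowS mul1r; apply: digit_lim_cantor => // i.
exact: digit_code_le.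
Qed.

Let expanding0 (x y : R) (j : 'I_m) : 0 <= x < 1 -> 0 <= y < 1 ->
  1 * `|z2 x j - z2 y j| <= eucl_dist (cons_row 0 (z2 x)) (cons_row 0 (z2 y)).
Proof.
move=> _ _; rewrite mul1r.
by have := eucl_norm_coord (cons_row 0 (z2 x) - cons_row 0 (z2 y)) (lift ord0 j);
  rewrite mxE [X in _ + X]mxE !cons_rowS.
Qed.

Lemma box_dim_ge_two_layers : box_dim_ge (@eucl_dist R m.+1) two_layers t.
Proof.
pose M : R := (11 ^ m)%:R; have M0 : 0 < M by rewrite ltr0n expn_gt0.
have P0 : 0 < (2 ^ m)%:R :> R by rewrite ltr0n expn_gt0.
(* [M] is the constant of [covering_size_ge], and [2 ^ m] pays for the gap between [r^(k+1)] and
   [r^k]. The bottom layer alone gives the bound. *)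
exists ((2 ^ m)%:R * M)^-1; first by rewrite invr_gt0 mulr_gt0.
move=> e n F e01 AF dF; have [k /andP[k1 k2]] := expr_scale r01 e01.
have e0 : 0 < e by case/andP: e01.
have := @covering_size_ge R 1 m r 1 _ _ _ r0 r4 isT ltr01 expanding0 n k F.
have dFk i : (diam (@eucl_dist R m.+1) (F i) <= (1 * r ^+ k)%:E)%E.
  by apply: (le_trans (dF i)); rewrite mul1r lee_fin.
have cF x : 0 <= x < 1 -> exists i, F i (cons_row 0 (z2 x)).
  by move=> x01; have [i _ Fi] := AF _ (layer0_code x); exists i.
move=> /(_ dFk cF) h; rewrite -ler_pdivlMl ?invr_gt0 ?mulr_gt0// invrK.
apply: (@le_trans _ _ ((2 ^ m)%:R * ((2 ^ m) ^ k)%:R)); last first.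
  by rewrite -mulrA ler_pM2l// mulrC.
rewrite -natrM -expnS powN !powRN lef_pV2 ?posrE ?powR_gt0 ?exprn_gt0//.
by apply: ge0_ler_powR; rewrite ?nnegrE ?(ltW t0) ?exprn_ge0 ?(ltW r0) ?(ltW e0) ?(ltW k1).
Qed.

Hypothesis m0 : (0 < m)%N.

Lemma hausdorff_dim_two_layers : hausdorff_dim (@eucl_dist R m.+1) two_layers = t%:E.
Proof.
apply/eqP; rewrite eq_le; apply/andP; split.
  apply: (@hausdorff_dim_le _ _ _ (@eucl_dist_ge0 R m.+1) _ (fun=> two_layers)).
  - exact: ltW.
  - by move=> v Av; exists 0.
  - by move=> _; exact: box_dim_le_two_layers.
exact: (@hausdorff_dim_ge R 1 m r 1 _ _ _ r0 r4 isT ltr01 expanding0 t m0 t0 rt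
  two_layers (fun x _ => layer0_code x)).
Qed.

(** * Directions of the differences between the layers *)

Let z4 (x : R) (j : 'I_m) : R := digit_lim r (digit_code 3 x j).

Let z4_bound x j : 0 <= z4 x j <= 4.
Proof.
have c3 i : (digit_code 3 x j i <= 3)%N by exact: digit_code_le.
have := digit_lim_ge r0 r4 0 c3; have := digit_lim_le r0 r4 0 c3.
by rewrite /digit_sum big_ord0 add0r expr0 mulr1 => -> ->.
Qed.

(** Split each digit 0 to 3 as [e + 2 f] with binary [e] and [f]. The [e] part is a point of the
    bottom layer, -2 times the [f] part one of the top layer, and their difference is the given
    vector. *)
Let direction_mem x (V : lines R m.+1) : val V = <[cons_row (-1) (z4 x)]>%VS ->
  ~ set_inj two_layers (perp_proj (val V)).
Proof.
move=> Vx; apply/not_inj_perp_projP.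
pose e (j : 'I_m) i := (digit_code 3 x j i %% 2)%N.
pose f (j : 'I_m) i := (digit_code 3 x j i %/ 2)%N.
have c3 (j : 'I_m) i : (digit_code 3 x j i <= 3)%N by exact: digit_code_le.
have e1 j i : (e j i <= 1)%N by rewrite -ltnS ltn_mod.
have f1 j i : (f j i <= 1)%N by exact: leq_trans (leq_div2r 2 (c3 j i)) _.
pose p := cons_row 0 (fun j => digit_lim r (e j)).
pose q := cons_row 1 (fun j => - 2 * digit_lim r (f j)).
have pqE : p - q = cons_row (-1) (z4 x).
  apply/rowP => i; rewrite !mxE; case: (unlift _ _) => [j|]; last by rewrite sub0r.
  rewrite mulNr opprK; apply/esym/digit_limD => // i'.
  - exact: leq_trans (e1 j i') _.
  - exact: leq_trans (f1 j i') _.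
  - by rewrite addnC mulnC; exact: divn_eq.
exists p, q; split.
- left; split; first by rewrite cons_row0.
  by move=> j; rewrite cons_rowS mul1r; exact: digit_lim_cantor.
- right; split; first by rewrite cons_row0.
  move=> j; rewrite cons_rowS mulrA (_ : _ * - 2 = 1); last by field.
  by rewrite mul1r; exact: digit_lim_cantor.
- rewrite pqE; apply/eqP => /rowP/(_ 0); rewrite cons_row0 mxE => /eqP.
  by rewrite oppr_eq0 oner_eq0.
- by rewrite pqE.
Qed.

(** Let [y] be the part of [u] orthogonal to [v]. The common height -1 gives
    [z j - w j = y_j + y_0 * w j], at most [5 |y|]; moreover [|y| <= lines_dist V W * |u|] and
    [|u| <= 4 (m+1)]. *)
Lemma line_cons_row_sep (V W : lines R m.+1) (z w : 'I_m -> R) j :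
  (forall i, 0 <= z i <= 4) -> (forall i, 0 <= w i <= 4) ->
  val V = <[cons_row (-1) z]>%VS -> val W = <[cons_row (-1) w]>%VS ->
  (20 * m.+1%:R)^-1 * `|z j - w j| <= lines_dist V W.
Proof.
move=> hz hw Vz Ww; rewrite ler_pdivrMl ?mulr_gt0//.
set u := cons_row (-1) z in Vz; set v := cons_row (-1) w in Ww.
have nu : eucl_norm u <= m.+1%:R * 4.
  apply: row_bound => [|i]; rewrite ?cons_row0 ?cons_rowS ?ler_norml; [lra|].
  have := hz i; lra.
have := lines_dist_ge Vz Ww; rewrite /line_proj; set a := _ / _.
set y := u - _ => hy.
have y0 := eucl_norm_coord y 0; have yj := eucl_norm_coord y (lift ord0 j).
have y0E : y 0 0 = a - 1 by rewrite /y !mxE unlift_none; ring.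
have yjE : y 0 (lift ord0 j) = z j - a * w j by rewrite /y !mxE liftK.
have -> : z j - w j = y 0 (lift ord0 j) + y 0 0 * w j by rewrite y0E yjE; ring.
apply: (le_trans (ler_normD _ _)); rewrite normrM.
have w4 : `|w j| <= 4 by have := hw j; rewrite ler_norml; lra.
have h1 : `|y 0 0| * `|w j| <= eucl_norm y * 4 by apply: ler_pM.
have h2 : lines_dist V W * eucl_norm u <= lines_dist V W * (m.+1%:R * 4).
  by rewrite ler_wpM2l// lines_dist_ge0.
lra.
Qed.

Hypothesis rt4 : (4 ^ m)%:R^-1 = r `^ (2 * t).

Lemma hausdorff_dim_not_inj_two_layers :
  hausdorff_dim (@lines_dist R m.+1)
    [set V : lines R m.+1 | ~ set_inj two_layers (perp_proj (val V))] = (2 * t)%:E.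
Proof.
apply/eqP; rewrite eq_le; apply/andP; split.
  apply: hausdorff_dim_not_inj_le; first exact: ltW.
  exact: box_dim_le_two_layers.
have ex x : exists V : lines R m.+1, val V = <[cons_row (-1) (z4 x)]>%VS.
  apply: line_of_vec; apply/eqP => /rowP/(_ 0); rewrite cons_row0 mxE => /eqP.
  by rewrite oppr_eq0 oner_eq0.
have [f hf] := choice ex.
have c0 : 0 < (20 * m.+1%:R)^-1 :> R by rewrite invr_gt0 mulr_gt0.
have exp4 x y (j : 'I_m) : 0 <= x < 1 -> 0 <= y < 1 ->
    (20 * m.+1%:R)^-1 * `|z4 x j - z4 y j| <= lines_dist (f x) (f y).
  by move=> _ _; apply: line_cons_row_sep => //; exact: z4_bound.
have t20 : 0 < 2 * t by rewrite mulr_gt0.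
apply: (@hausdorff_dim_ge R 3 m r _ _ _ f r0 r4 isT c0 exp4 (2 * t) m0 t20 rt4).
by move=> x _; exact: direction_mem (hf x).
Qed.

End TwoLayers.

(** * Choice of the contraction ratio *)

Theorem corollary2p5 (R : realType) (d : nat) (hd : (2 <= d)%N)
    (t : R) (t_gt0 : 0 < t) (t_le : t <= (d%:R - 1) / 2) :
  exists A : set 'rV[R]_d,
    [/\ compact A,
        hausdorff_dim (@eucl_dist R d) A = t%:E,
        has_box_dim (@eucl_dist R d) A t &
        hausdorff_dim (@lines_dist R d)
          [set V : lines R d | ~ set_inj A (perp_proj (val V))] = (2 * t)%:E].
Proof.
case: d hd t_le => [|m]// m0; rewrite -natr1 addrK => t_le.
(* The solution of [2^m r^t = 1]; squaring gives [4^m r^(2t) = 1]. *)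
pose r : R := 2 `^ (- (m%:R / t)).
have r0 : 0 < r by rewrite powR_gt0.
have rpow s : r `^ (s * t) = 2 `^ (- (m%:R * s)).
  by rewrite /r -powRrM; congr powR; field; rewrite gt_eqF.
have rt : (2 ^ m)%:R^-1 = r `^ t.
  by rewrite -[in RHS](mul1r t) rpow mulr1 powRN powR_mulrn// natrX.
have rt4 : (4 ^ m)%:R^-1 = r `^ (2 * t).
  by rewrite rpow -natrM powRN powR_mulrn// -natrX mulnC expnM.
(* The bound [t <= m / 2] enters here: it says [m / t >= 2]. *)
have r4 : r <= 4^-1.
  rewrite (_ : 4^-1 = 2 `^ (- 2%:R)); last by rewrite powRN powR_mulrn// -natrX.
  apply: ler_powR; rewrite ?ler1n// lerN2 ler_pdivlMr//; lra.
exists (two_layers r); split.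
- exact: compact_two_layers.
- exact: hausdorff_dim_two_layers.
- by apply: has_box_dim_bounds; [exact: box_dim_le_two_layers|exact: box_dim_ge_two_layers].
- exact: hausdorff_dim_not_inj_two_layers.
Qed.
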